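(* Let $X$ be a locally complete locally convex Hausdorff space and let $T\in\mathcal{L}(X)$ be a bounded operator satisfying $\sigma(T;X)\subseteq\overline{B(0,\delta)}$ for some $\delta\in(0,1)$. Then $T^n\to0$ in $\mathcal{L}_b(X)$ as $n\to\infty$. In particular, $T$ is both power bounded and uniformly mean ergodic.
   Context: All spaces are over $\mathbb{C}$. For a locally convex Hausdorff space $X$: $\mathcal{L}(X)$ is the space of continuous linear operators on $X$; $\mathcal{L}_b(X)$ is $\mathcal{L}(X)$ with the topology of uniform convergence on bounded subsets of $X$. $X$ is locally complete if, for each closed, absolutely convex, bounded set $B\subseteq X$, the space $X_B:=\mathrm{span}(B)$ equipped with the Minkowski functional $\|\cdot\|_B$ of $B$ is a Banach space. A linear operator $T:X\to X$ is bounded if there is a neighbourhood $\mathcal{U}$ of $0\in X$ such that $T(\mathcal{U})$ is a bounded subset of $X$. For $T\in\mathcal{L}(X)$, $\sigma(T;X)$ is the set of $\lambda\in\mathbb{C}$ for which $\lambda I-T$ has no inverse in $\mathcal{L}(X)$. $B(0,\delta):=\{z\in\mathbb{C}:|z|<\delta\}$. $T$ is power bounded if $\{T^n:n\in\mathbb{N}\}$ is equicontinuous, and uniformly mean ergodic if the sequence $T_{[n]}:=\frac1n\sum_{m=1}^nT^m$, $n\in\mathbb{N}$, converges in $\mathcal{L}_b(X)$. *)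

(* Defs.v *)
From HB Require Import structures.
From mathcomp Require Import all_boot all_order all_algebra.
From mathcomp Require Import all_classical all_reals all_analysis.
From mathcomp Require Export complex.

Set Implicit Arguments.
Unset Strict Implicit.
Unset Printing Implicit Defensive.

Import Order.TTheory GRing.Theory Num.Theory.
Import numFieldNormedType.Exports.

Local Open Scope classical_set_scope.
Local Open Scope ring_scope.
Local Open Scope complex_scope.

(* A [tvsType K] is a locally convex space, but its uniformity is only required
   to induce the topology: it need not be the translation-invariant one.  All
   the notions below (boundedness, equicontinuity, uniform convergence on
   bounded sets) therefore go through neighbourhoods of 0 instead of
   [entourage], hence do not reuse [equicontinuous] or [{family _, _ -> _}]. *)

Section bounded_sets.
Context {K : numFieldType} {X : tvsType K}.

Definition tvs_bounded (B : set X) : Prop :=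
  forall U : set X, nbhs 0 U -> exists2 r : K, 0 < r & B `<=` ( *:%R r) @` U.

Definition absolutely_convex (B : set X) : Prop :=
  forall (a b : K) (x y : X), `|a| + `|b| <= 1 -> B x -> B y ->
    B (a *: x + b *: y).

Definition linear_span (B : set X) : set X :=
  [set x | exists (n : nat) (a : 'I_n -> K) (b : 'I_n -> X),
     (forall i, B (b i)) /\ x = \sum_(i < n) a i *: b i].

Lemma tvs_bounded0 : tvs_bounded set0.
Proof. by move=> U U0; exists 1. Qed.

Lemma nbhs0_balanced (U : set X) : nbhs 0 U ->
  exists2 V, nbhs 0 V & forall (a : K) x, `|a| <= 1 -> V x -> U (a *: x).
Proof.
move=> U0; have /= := @scale_continuous K X (0, 0) U.
rewrite scaler0 => /(_ U0) [[A W] /= [A0 W0] AWU].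
have [e /= e0 eA] := A0.
pose r := e / 2; have r0 : 0 < r by rewrite divr_gt0.
exists (( *:%R r) @` W); first by apply: nbhs0Z => //; rewrite gt_eqF.
move=> a _ a1 [w Ww <-]; rewrite scalerA; apply: (AWU (a * r, w)); split => //=.
apply: eA; rewrite /= sub0r normrN normrM (gtr0_norm r0).
apply: (@le_lt_trans _ _ r); first by rewrite ler_piMl // ltW.
by rewrite /r ltr_pdivrMr// ltr_pMr// ltr1n.
Qed.

Lemma tvs_boundedU (A B : set X) :
  tvs_bounded A -> tvs_bounded B -> tvs_bounded (A `|` B).
Proof.
move=> bA bB U /nbhs0_balanced[V V0 VU].
have [r r0 Ar] := bA _ V0; have [s s0 Bs] := bB _ V0.
have rs0 : 0 < r + s by rewrite addr_gt0.
have scale t x : 0 < t -> t <= r + s -> V x ->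
    (( *:%R (r + s)) @` U) (t *: x).
  move=> t0 trs Vx; exists ((t / (r + s)) *: x); last first.
    by rewrite scalerA mulrCA divff ?mulr1// gt_eqF.
  have ts0 : 0 <= t / (r + s) by rewrite divr_ge0 ?ltW.
  by apply: VU => //; rewrite (ger0_norm ts0) ler_pdivrMr// mul1r.
exists (r + s) => // x [/Ar|/Bs] [u Vu <-]; apply: scale => //.
  by rewrite lerDl ltW.
by rewrite lerDr ltW.
Qed.

End bounded_sets.

(* The space L(X) of continuous linear operators on X. *)
Section continuous_operators.
Context {K : numFieldType} {X : tvsType K}.

Definition contop_pred : pred (X -> X) :=
  fun f => `[< linear f /\ continuous f >].

Record contop := Contop { contop_fun :> X -> X; _ : contop_pred contop_fun }.

HB.instance Definition _ := [isSub for contop_fun].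
HB.instance Definition _ := [Choice of contop by <:].

Lemma contopP (S : contop) : linear S /\ continuous S.
Proof. by case: S => f /= /asboolP. Qed.

Lemma contop_linear (S : contop) : linear S.
Proof. by have [] := contopP S. Qed.

HB.instance Definition _ (S : contop) :=
  GRing.isLinear.Build K X X _ (contop_fun S) (contop_linear S).

Lemma contop_continuous (S : contop) : continuous S.
Proof. by have [] := contopP S. Qed.

Lemma contop_eq (S S' : contop) : (forall x, S x = S' x) -> S = S'.
Proof. by move=> SS'; apply/val_inj/funext. Qed.

Definition to_contop (f : X -> X) (lf : linear f) (cf : continuous f) : contop :=
  Contop (introT (asboolP (_ /\ _)) (conj lf cf)).

Lemma contop_submod_closed : submod_closed contop_pred.
Proof.
split.
  apply/asboolP; split; last by move=> x; exact: cvg_cst.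
  by move=> a x y /=; rewrite scaler0 addr0.
move=> a f g /asboolP[lf cf] /asboolP[lg cg]; apply/asboolP; split.
  move=> b x y; rewrite !fctE lf lg !scalerDr !scalerA [b * a]mulrC.
  by rewrite addrACA.
move=> x; apply: (@continuous_comp _ _ _ (fun x => (a *: f x, g x))
    (fun z : X * X => z.1 + z.2)); last exact: add_continuous.
apply: cvg_pair; last exact: cg.
apply: (@continuous_comp _ _ _ (fun x => (a, f x) : K^o * X)
    (fun z : K^o * X => z.1 *: z.2)); last exact: scale_continuous.
have ca : (fun _ : X => a : K^o) @ x --> (a : K^o) by exact: cvg_cst.
exact: (cvg_pair ca (cf x)).
Qed.

HB.instance Definition _ :=
  GRing.SubChoice_isSubLmodule.Build K (X -> X) contop_pred contop
    contop_submod_closed.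

Definition contop_id : contop :=
  @to_contop id (fun _ _ _ => erefl) (fun _ => cvg_id).

Lemma comp_contop_linear (S S' : contop) : linear (S \o S').
Proof. by move=> a x y; rewrite /= !linearP. Qed.

Lemma comp_contop_continuous (S S' : contop) : continuous (S \o S').
Proof. by move=> x; apply: continuous_comp; exact: contop_continuous. Qed.

Definition contop_comp (S S' : contop) : contop :=
  to_contop (@comp_contop_linear S S') (@comp_contop_continuous S S').

Let compA : associative contop_comp.
Proof. by move=> *; exact: contop_eq. Qed.
Let comp1l : left_id contop_id contop_comp.
Proof. by move=> *; exact: contop_eq. Qed.
Let compl1 : right_id contop_id contop_comp.
Proof. by move=> *; exact: contop_eq. Qed.
Let compDl : left_distributive contop_comp +%R.
Proof. by move=> *; exact: contop_eq. Qed.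
Let compDr : right_distributive contop_comp +%R.
Proof. by move=> S S1 S2; apply: contop_eq => x /=; rewrite linearD. Qed.

HB.instance Definition _ :=
  GRing.Zmodule_isPzRing.Build contop compA comp1l compl1 compDl compDr.

Lemma contop0E (x : X) : (0 : contop) x = 0. Proof. by []. Qed.
Lemma contop1E (x : X) : (1 : contop) x = x. Proof. by []. Qed.
Lemma contopDE (S S' : contop) x : (S + S') x = S x + S' x. Proof. by []. Qed.
Lemma contopBE (S S' : contop) x : (S - S') x = S x - S' x. Proof. by []. Qed.
Lemma contopZE (a : K) (S : contop) x : (a *: S) x = a *: S x.
Proof. by []. Qed.
Lemma contopME (S S' : contop) x : (S * S') x = S (S' x). Proof. by []. Qed.
Lemma contopXE (S : contop) n x : (S ^+ n) x = iter n S x.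
Proof.
by elim: n => [|n IH] //; rewrite exprS contopME IH.
Qed.

(* The topology of uniform convergence on bounded sets, i.e. L_b(X). *)
Definition contop_entourage : set_system (contop * contop) :=
  [set E | exists B U : set X, [/\ tvs_bounded B, nbhs 0 U &
    [set SS' : contop * contop | forall x, B x -> U (SS'.1 x - SS'.2 x)] `<=` E]].

Lemma contop_entourage_filter : Filter contop_entourage.
Proof.
split.
- by exists set0, setT; split=> //; [exact: tvs_bounded0|exact: filterT].
- move=> P Q [B [U [bB U0 BUP]]] [C [V [bC V0 CVQ]]].
  exists (B `|` C), (U `&` V); split; [exact: tvs_boundedU|exact: filterI|].
  move=> SS' h; split.
    by apply: BUP => x Bx; have [] := h x (or_introl Bx).
  by apply: CVQ => x Cx; have [] := h x (or_intror Cx).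
- move=> P Q PQ [B [U [bB U0 BUP]]]; exists B, U; split=> //.
  exact: subset_trans PQ.
Qed.

Lemma contop_entourage_diagonal E : contop_entourage E -> diagonal `<=` E.
Proof.
move=> [B [U [_ U0 BUE]]] [S S']; rewrite /diagonal /= => ->; apply: BUE => x _ /=.
by rewrite subrr; exact: nbhs_singleton.
Qed.

Lemma contop_entourage_inv E :
  contop_entourage E -> contop_entourage E^-1%relation.
Proof.
move=> [B [U [bB U0 BUE]]]; exists B, (-%R @` U); split=> //; first exact: nbhs0N.
move=> [S S'] /= h; apply: BUE => x /h [u Uu] /= uE.
by rewrite -opprB -uE opprK.
Qed.

Lemma contop_entourage_split E : contop_entourage E ->
  exists2 F, contop_entourage F & (F \; F)%relation `<=` E.
Proof.
move=> [B [U [bB U0 BUE]]].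
have := @add_continuous X (0, 0) U; rewrite /= addr0.
move=> /(_ U0) [[V W] /= [V0 W0] VWU].
exists [set SS' : contop * contop | forall x, B x -> (V `&` W) (SS'.1 x - SS'.2 x)].
  by exists B, (V `&` W); split => //; exact: filterI.
move=> [S S'] /= [Q SQ QS']; apply: BUE => x Bx /=.
have [Vx _] := SQ _ Bx; have [_ Wx] := QS' _ Bx.
have := VWU (S x - Q x, Q x - S' x) (conj Vx Wx).
by rewrite /= addrA subrK.
Qed.

HB.instance Definition _ := isUniform.Build contop
  contop_entourage_filter contop_entourage_diagonal
  contop_entourage_inv contop_entourage_split.

Lemma contop_nbhsP (S : contop) (A : set contop) : nbhs S A <->
  exists B U : set X, [/\ tvs_bounded B, nbhs 0 U &
    forall S' : contop, (forall x, B x -> U (S x - S' x)) -> A S'].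
Proof.
rewrite nbhsP; split.
  move=> [E [B [U [bB U0 BUE]]] EA]; exists B, U; split => // S' h.
  by apply/EA/mem_set/BUE.
move=> [B [U [bB U0 BUA]]].
exists [set SS' : contop * contop | forall x, B x -> U (SS'.1 x - SS'.2 x)].
  by exists B, U; split.
by move=> S' /set_mem; exact: BUA.
Qed.

End continuous_operators.
Arguments contop {K} X.

Section operator_notions.
Context {K : numFieldType} {X : tvsType K}.

Definition bounded_operator (T : contop X) : Prop :=
  exists2 U : set X, nbhs 0 U & tvs_bounded (T @` U).

Definition spectrum (T : contop X) : set K :=
  [set l : K | ~ exists S : contop X,
     (l *: (1 : contop X) - T) * S = 1 /\ S * (l *: (1 : contop X) - T) = 1].

Definition equicontinuous_set (H : set (contop X)) : Prop :=
  forall U : set X, nbhs 0 U ->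
    exists2 V : set X, nbhs 0 V & forall S, H S -> S @` V `<=` U.

Definition power_bounded (T : contop X) : Prop :=
  equicontinuous_set [set T ^+ n | n in [set n : nat | (0 < n)%N]].

Definition ergodic_mean (T : contop X) (n : nat) : contop X :=
  n%:R^-1 *: \sum_(1 <= m < n.+1) T ^+ m.

Definition uniformly_mean_ergodic (T : contop X) : Prop :=
  exists P : contop X, ergodic_mean T @ \oo --> P.

End operator_notions.

Section local_completeness.
Context {R : realType} {X : tvsType R[i]}.

Definition minkowski_functional (B : set X) (x : X) : R :=
  inf [set r : R | 0 < r /\ (( *:%R r%:C) @` B) x].

(* (X_B, ||.||_B) is a Banach space: it is isometric, through the linear map j,
   to a complete normed space. *)
Definition XB_is_banach (B : set X) : Prop :=
  exists (V : completeNormedModType R[i]) (j : {linear V -> X}),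
    [/\ injective j, range j = linear_span B &
        forall v : V, `|v| = (minkowski_functional B (j v))%:C].

End local_completeness.

Definition locally_complete {R : realType} (X : tvsType R[i]) : Prop :=
  forall B : set X, closed B -> absolutely_convex B -> tvs_bounded B ->
    XB_is_banach B.

(* Main.v *)
Require Import Defs.
From mathcomp Require Import all_boot all_order all_algebra.
From mathcomp Require Import all_classical all_reals all_analysis.
From mathcomp Require Import ring lra.
Set Implicit Arguments.
Unset Strict Implicit.
Unset Printing Implicit Defensive.
Import Order.TTheory GRing.Theory Num.Theory.
Import numFieldNormedType.Exports.

Local Open Scope classical_set_scope.
Local Open Scope ring_scope.
Local Open Scope complex_scope.

(* Let U be an absolutely convex neighbourhood of 0 with T(U) bounded.  For
   continuous F, F(T(U)) is again bounded, so F T maps U into a multiple of U;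
   hence so does every resolvent (1 - z T)^-1 = 1 + z (1 - z T)^-1 T.  Measuring
   operators by the gauge of U, the claim reduces to a spectral radius estimate
   in a seminormed algebra.  There, following Rickart, holomorphy is replaced by
   averaging: the resolvent is Lipschitz on a disc of radius rho > 1, and the
   inverses (1 - s^n T^n)^-1, n = 2^k, being averages of resolvents of T, are
   Lipschitz in s uniformly in n.  So the property "s^n T^n tends to 0 along
   n = 2^k" propagates in s by steps of constant length, from s = 0 to s = 1.
   Finally T^(n+1) = T T^n and T_[n] = n^-1 T (1 - T)^-1 (1 - T^n), and T turns
   smallness in the gauge of U into smallness in L_b(X). *)

(** * Moduli of complex numbers *)

Lemma norm_real_complex (R : realType) (r : R) : `|r%:C| = `|r|%:C.
Proof. by rewrite (@normc_def R r%:C) /= expr0n /= addr0 sqrtr_sqr. Qed.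

Lemma real_norm_complex (R : realType) (z : R[i]) : `|z| = (complex.Re `|z|)%:C.
Proof. by rewrite RRe_real // normr_real. Qed.

Lemma norm_complex_le (R : realType) (z : R[i]) :
  `|z| <= (`|complex.Re z| + `|complex.Im z|)%:C.
Proof.
rewrite [z in `|z|]complexE (le_trans (ler_normD _ _)) // normrM.
rewrite !norm_real_complex rmorphD lerD2l ler_piMl ?normr_ge0 //.
  by rewrite ler0c normr_ge0.
by rewrite (normc_def 'i%C) /= expr0n expr1n add0r sqrtr1.
Qed.

(** * Algebra of two-sided inverses and of operators *)

Section inverses.
Context {A : pzRingType}.
Implicit Types a b f g : A.

Definition mutual_inverse a f := a * f = 1 /\ f * a = 1.

(** The resolvent identity: inserting b g = 1 and f a = 1 turns the difference into a product. *)
Lemma mutual_inverse_sub a b f g :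
  mutual_inverse a f -> mutual_inverse b g -> f - g = f * (b - a) * g.
Proof.
move=> [_ fa] [bg _].
by rewrite mulrBr mulrBl fa mul1r -mulrA bg mulr1.
Qed.

Lemma mutual_inverse_1Bsqr a f g :
  mutual_inverse (1 - a) f -> mutual_inverse (1 + a) g ->
  (1 - a * a) * (f + g) = 1 + 1 /\ (f + g) * (1 - a * a) = 1 + 1.
Proof.
move=> [af fa] [ag ga].
have E1 : 1 - a * a = (1 + a) * (1 - a).
  by rewrite mulrDl mul1r mulrBr mulr1 addrA subrK.
have E2 : 1 - a * a = (1 - a) * (1 + a).
  by rewrite mulrBl mul1r mulrDr mulr1 opprD addrA addrK.
have S : 1 + a + (1 - a) = 1 + 1 by rewrite addrACA subrr addr0.
split; first by rewrite mulrDr {1}E1 E2 -!mulrA af ag !mulr1 S.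
by rewrite mulrDl {1}E2 E1 !mulrA fa ga !mul1r S.
Qed.

End inverses.

Lemma contop_scalerAl (K : numFieldType) (X : tvsType K) (z : K)
  (A B : contop X) : (z *: A) * B = z *: (A * B).
Proof. exact: contop_eq. Qed.

Lemma contop_scalerAr (K : numFieldType) (X : tvsType K) (z : K)
  (A B : contop X) : A * (z *: B) = z *: (A * B).
Proof. by apply: contop_eq => x; rewrite contopME !contopZE linearZ. Qed.

(** * Operator bounds relative to an absolutely convex set *)

Section relative_bounds.
Context {R : realType} {X : tvsType R[i]} {U : set X}.
Context (Uac : absolutely_convex U) (U0 : U 0).
Implicit Types (A B : contop X) (c d : R).

(** Stands in for an operator seminorm bound with respect to the gauge of [U], without forming the
    gauge. The value c = 0 is allowed and forces [A] to vanish on [U]. *)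
Definition bounded_by A c :=
  0 <= c /\ forall x, U x -> exists2 u, U u & A x = c%:C *: u.

Lemma absolutely_convexZ (a : R[i]) x : `|a| <= 1 -> U x -> U (a *: x).
Proof.
move=> a1 Ux; have := @Uac a 0 x 0.
by rewrite normr0 addr0 scaler0 addr0; apply.
Qed.

Lemma absolutely_convex_scale_le (z : R[i]) d x :
  `|z| <= d%:C -> U x -> exists2 u, U u & z *: x = d%:C *: u.
Proof.
move=> zd Ux; have [d0|d0] := eqVneq d 0.
  exists 0 => //; rewrite scaler0.
  by move: zd; rewrite d0 normr_le0 => /eqP->; rewrite scale0r.
have d0' : d%:C != 0 by rewrite -(rmorph0 (real_complex R)) (inj_eq (fmorph_inj _)).
have dp : 0 < d%:C.
  by rewrite lt_neqAle eq_sym d0' (le_trans _ zd).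
exists ((z / d%:C) *: x).
  apply: absolutely_convexZ => //.
  by rewrite normrM normfV (gtr0_norm dp) ler_pdivrMr // mul1r.
by rewrite scalerA mulrCA divff // mulr1.
Qed.

Lemma bounded_by_le A c d : bounded_by A c -> c <= d -> bounded_by A d.
Proof.
move=> [c0 bA] cd; split; first exact: le_trans cd.
move=> x /bA[u Uu ->]; apply: absolutely_convex_scale_le => //.
by rewrite norm_real_complex lecR ger0_norm.
Qed.

Lemma bounded_by1 : bounded_by 1 1.
Proof. by split=> // x Ux; exists x => //; rewrite scale1r. Qed.

Lemma bounded_byZ A c (z : R[i]) d :
  `|z| <= d%:C -> bounded_by A c -> bounded_by (z *: A) (d * c).
Proof.
move=> zd [c0 bA]; have d0 : 0 <= d by rewrite -ler0c (le_trans _ zd).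
split; first exact: mulr_ge0.
move=> x /bA[u Uu Ax]; rewrite contopZE Ax scalerA.
apply: absolutely_convex_scale_le => //.
by rewrite normrM norm_real_complex rmorphM (ger0_norm c0) ler_wpM2r // ler0c.
Qed.

Lemma bounded_byD A B c d :
  bounded_by A c -> bounded_by B d -> bounded_by (A + B) (c + d).
Proof.
move=> [c0 bA] [d0 bB]; split; first exact: addr_ge0.
move=> x Ux; rewrite contopDE.
have [u Uu ->] := bA _ Ux; have [v Uv ->] := bB _ Ux.
have [/eqP|cd0] := eqVneq (c + d) 0.
  rewrite paddr_eq0 // => /andP[/eqP -> /eqP ->].
  by exists 0 => //; rewrite addr0 !scale0r addr0.
have cd0' : (c + d)%:C != 0 :> R[i].
  by rewrite -(rmorph0 (real_complex R)) (inj_eq (fmorph_inj _)).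
exists ((c / (c + d))%:C *: u + (d / (c + d))%:C *: v).
  apply: Uac => //; rewrite !norm_real_complex -rmorphD.
  rewrite -(rmorph1 (real_complex R)) lecR !ger0_norm ?divr_ge0 ?addr_ge0 //.
  by rewrite -mulrDl divff.
by rewrite scalerDr !scalerA -!rmorphM !(mulrC (c + d)) !divfK.
Qed.

Lemma bounded_byN A c : bounded_by A c -> bounded_by (- A) c.
Proof.
move=> bA; rewrite -scaleN1r -[c]mul1r; apply: bounded_byZ => //.
by rewrite normrN1.
Qed.

Lemma bounded_byB A B c d :
  bounded_by A c -> bounded_by B d -> bounded_by (A - B) (c + d).
Proof. by move=> bA /bounded_byN; exact: bounded_byD. Qed.

Lemma bounded_byM A B c d :
  bounded_by A c -> bounded_by B d -> bounded_by (A * B) (c * d).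
Proof.
move=> [c0 bA] [d0 bB]; split; first exact: mulr_ge0.
move=> x /bB[u Uu Bx]; have [v Uv Au] := bA _ Uu.
exists v => //; rewrite contopME Bx linearZ /= Au scalerA -rmorphM.
by rewrite mulrC.
Qed.

Lemma bounded_byX A c n : bounded_by A c -> bounded_by (A ^+ n) (c ^+ n).
Proof.
move=> bA; elim: n => [|n IH]; first exact: bounded_by1.
by rewrite !exprS; exact: bounded_byM.
Qed.

(** Iterating e -> d + e/2 from the a priori bound [c] yields 2d + c/2^k, and a large [k] brings the
    last term below 1. The limit 2d itself is out of reach, since [U] is not assumed closed. *)
Lemma bounded_by_absorb A c d : 0 <= d -> bounded_by A c ->
  (forall e, bounded_by A e -> bounded_by A (d + e / 2)) ->
  bounded_by A (d * 2 + 1).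
Proof.
move=> d0 bA half; have c0 : 0 <= c by case: bA.
have iter k : bounded_by A (d * 2 + c / 2 ^+ k).
  elim: k => [|k /half]; first by apply: bounded_by_le bA _; rewrite divr1; lra.
  congr bounded_by; rewrite exprS invfM; lra.
apply: bounded_by_le (iter (Num.bound c)) _; rewrite lerD2l.
rewrite ler_pdivrMr ?exprn_gt0 // mul1r.
rewrite (le_trans (ltW (archi_boundP c0))) //.
by rewrite -natrX ler_nat ltnW // ltn_expl.
Qed.

End relative_bounds.
Arguments bounded_by {R X} U A c.

(** * From local to uniform bounds on a closed disc *)

Lemma bounded_complex_disc_cover (R : realType) (rho : R)
    (P : R[i] -> R -> Prop) :
  (forall z m m', P z m -> m <= m' -> P z m') ->
  (forall z0, exists e m, 0 < e /\
     forall z, `|z - z0| < e%:C -> `|z| <= rho%:C -> P z m) ->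
  exists m, forall z, `|z| <= rho%:C -> P z m.
Proof.
move=> Pmono Ploc.
(* The disc sits in the square [-rho, rho]^2, a product of compact segments. Letting [m] tend to +oo
   encodes the choice of one bound that dominates finitely many local ones. *)
have /compact_near_coveringP/(_ R (pinfty_nbhs R)
    (fun m x => `|x.1%:C + 'i%C * x.2%:C| <= rho%:C ->
                P (x.1%:C + 'i%C * x.2%:C) m)) :=
  compact_setX (@segment_compact R (- rho) rho) (@segment_compact R (- rho) rho).
case.
  move=> [a b] _ /=; have [e [m [e0 Pm]]] := Ploc (a%:C + 'i%C * b%:C).
  exists (ball (a, b) (e / 2), [set m' | m <= m']).
    split => /=; first by apply: nbhsx_ballx; rewrite divr_gt0.
    by apply: nbhs_pinfty_ge; exact: num_real.
  move=> [[x y] m'] /= [[xa yb] mm'] xyr; apply: Pmono mm'; apply: Pm => //.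
  apply: le_lt_trans (norm_complex_le _) _; rewrite ltcR.
  have -> : complex.Re (x%:C + 'i%C * y%:C - (a%:C + 'i%C * b%:C)) = x - a.
    by rewrite /= ; ring.
  have -> : complex.Im (x%:C + 'i%C * y%:C - (a%:C + 'i%C * b%:C)) = y - b.
    by rewrite /= ; ring.
  rewrite [e]splitr; apply: ltrD.
    by rewrite distrC; move: xa; rewrite /= -ball_normE.
  by rewrite distrC; move: yb; rewrite /= -ball_normE.
move=> m0 [_ Hm]; exists (m0 + 1) => z zr.
have m01 : m0 < m0 + 1 by rewrite ltrDl.
have := Hm _ m01 (complex.Re z, complex.Im z); rewrite /= -complexE; apply => //.
(* As Re (i z) = - Im z, one inequality bounds both coordinates. *)
have := normc_ge_Re z; have := normc_ge_Re ('i%C * z).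
rewrite normrM normCi mul1r => /le_trans/(_ zr) + /le_trans/(_ zr).
rewrite !lecR /= !ler_norml /=.
case: z {zr} => x y /=; rewrite !in_itv /= => /andP[h1 h2] ->.
by split => //; apply/andP; split; lra.
Qed.

(** * Bounds on the resolvent (1 - z T)^-1 *)

Section resolvent.
Context {R : realType} {X : tvsType R[i]} {U : set X}.
Context (Uac : absolutely_convex U) (U0 : U 0).
Context {T : contop X} {t rho : R} (bT : bounded_by U T t).
Context (bFT : forall F : contop X, exists r, bounded_by U (F * T) r).
Context (rhoT : forall z : R[i], `|z| <= rho%:C ->
  exists F, mutual_inverse (1 - z *: T) F).

(** Gives finiteness only, as [r] depends on [F]. Such a bound starts the absorption argument, which
    replaces it by one that is locally uniform in [z]. *)
Lemma resolvent_bounded z F : mutual_inverse (1 - z *: T) F ->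
  exists c, bounded_by U F c.
Proof.
move=> [_ FT]; have [r bF] := bFT F.
exists (1 + complex.Re `|z| * r).
have -> : F = 1 + z *: (F * T).
  by rewrite -contop_scalerAr -FT mulrBr mulr1 subrK.
apply: bounded_byD => //; first exact: bounded_by1.
by apply: bounded_byZ => //; rewrite -real_norm_complex.
Qed.

Lemma resolvent_lipschitz z w F G a b d :
  mutual_inverse (1 - z *: T) F -> mutual_inverse (1 - w *: T) G ->
  bounded_by U F a -> bounded_by U G b -> `|z - w| <= d%:C ->
  bounded_by U (F - G) (d * (a * t * b)).
Proof.
move=> zF wG Fa Gb zwd; rewrite (mutual_inverse_sub zF wG).
have -> : 1 - w *: T - (1 - z *: T) = (z - w) *: T.
  by rewrite opprB addrC addrA subrK scalerBl.
rewrite contop_scalerAr contop_scalerAl; apply: bounded_byZ => //.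
by apply: bounded_byM => //; exact: bounded_byM.
Qed.

Lemma resolvent_locally_bounded z0 : exists e m, 0 < e /\
  forall z, `|z - z0| < e%:C -> `|z| <= rho%:C ->
  exists2 F, mutual_inverse (1 - z *: T) F & bounded_by U F m.
Proof.
have [z0r|z0r] := boolP (`|z0| <= rho%:C); last first.
  have {}z0r : rho < complex.Re `|z0|.
    by rewrite ltNge; apply: contra z0r; rewrite real_norm_complex lecR.
  (* Off the disc the claim is vacuous: this radius keeps the neighbourhood of [z0] away from it. *)
  exists (complex.Re `|z0| - rho), 0; split; first by rewrite subr_gt0.
  move=> z zz0 zr; exfalso.
  have := ler_distD z z0 0; rewrite !subr0 distrC => /le_lt_trans.
  move=> /(_ _ (ltr_leD zz0 zr)); rewrite -rmorphD subrK.
  by rewrite /= -real_norm_complex ltxx.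
have [F0 zF0] := rhoT z0r; have [m bF0] := resolvent_bounded zF0.
have m0 : 0 <= m by case: bF0.
have t0 : 0 <= t by case: bT.
have tm0 : 0 < t * m + 1 by rewrite ltr_wpDl // mulr_ge0.
(* With this radius the Lipschitz estimate bounds F - F0 by e t m / (2 (t m + 1)) <= e/2 for every
   bound [e] of [F]; absorption then gives 2m + 1. *)
exists (2^-1 / (t * m + 1)), (m * 2 + 1).
split; first by rewrite divr_gt0.
move=> z /ltW zz0 /rhoT[F zF]; exists F => //.
have [c bF] := resolvent_bounded zF.
apply: (bounded_by_absorb Uac U0 _ bF) => // e bFe.
have -> : F = F0 + (F - F0) by rewrite addrC subrK.
have := bounded_byD Uac U0 bF0 (resolvent_lipschitz zF zF0 bFe bF0 zz0).
move=> h; apply: (bounded_by_le Uac U0 h); rewrite lerD2l.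
have e0 : 0 <= e by case: bFe.
rewrite -[_ / _ * _]mulrA [leRHS]mulrC ler_pM2l // mulrC.
rewrite ler_pdivrMr // mulrDr mulr1 -mulrA ler_wpDr //.
Qed.

Lemma resolvent_uniformly_bounded : exists m, forall z, `|z| <= rho%:C ->
  exists2 F, mutual_inverse (1 - z *: T) F & bounded_by U F m.
Proof.
apply: bounded_complex_disc_cover; last exact: resolvent_locally_bounded.
move=> z m m' [F zF bF] mm'; exists F => //.
exact: bounded_by_le Uac U0 _ _ _ bF mm'.
Qed.

End resolvent.

(** * Resolvents of T^(2^k) and decay of the powers *)

Section dyadic_resolvents.
Context {R : realType} {X : tvsType R[i]} {U : set X}.
Context (Uac : absolutely_convex U) (U0 : U 0).
Context {T : contop X} {t rho m : R} (bT : bounded_by U T t).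
Context (Tm : forall z : R[i], `|z| <= rho%:C ->
  exists2 F, mutual_inverse (1 - z *: T) F & bounded_by U F m).

(* The resolvents of [T ^+ (2 ^ k)] are averages of resolvents of [T], through
   [2 (1 - a^2)^-1 = (1 - a)^-1 + (1 + a)^-1]; hence the bound and the modulus
   of continuity do not depend on [k]. *)
Lemma dyadic_resolvent_mean k (z v : R[i]) F1 F2 :
  mutual_inverse (1 - (z * v) *: T ^+ (2 ^ k)) F1 ->
  mutual_inverse (1 - (z * - v) *: T ^+ (2 ^ k)) F2 ->
  mutual_inverse (1 - (z ^+ 2 * v ^+ 2) *: T ^+ (2 ^ k.+1))
    (2^-1 *: (F1 + F2)).
Proof.
set a := (z * v) *: T ^+ (2 ^ k) => aF1.
have -> : 1 - (z * - v) *: T ^+ (2 ^ k) = 1 + a.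
  by rewrite mulrN scaleNr opprK.
have -> : 1 - (z ^+ 2 * v ^+ 2) *: T ^+ (2 ^ k.+1) = 1 - a * a.
  by rewrite contop_scalerAl contop_scalerAr scalerA expnS mulSn mul1n exprD
    -exprMn expr2.
move=> aF2; have [E1 E2] := mutual_inverse_1Bsqr aF1 aF2.
have half : (2^-1 : R[i]) *: ((1 + 1) : contop X) = 1.
  have -> : (1 + 1 : contop X) = (2 : R[i]) *: (1 : contop X).
    by rewrite scaler_nat.
  by rewrite scalerA mulVf ?scale1r // pnatr_eq0.
by split; [rewrite contop_scalerAr E1|rewrite contop_scalerAl E2]; exact: half.
Qed.

Lemma bounded_by_mean A B c :
  bounded_by U A c -> bounded_by U B c -> bounded_by U (2^-1 *: (A + B)) c.
Proof.
move=> bA bB.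
have -> : c = 2^-1 * (c + c) by lra.
apply: bounded_byZ => //; last exact: bounded_byD.
by rewrite normfV normr_nat fmorphV rmorph_nat.
Qed.

(** The induction runs over all [u] in the unit disc because the step needs both square roots of
    [u]. [F] and [G] are built together, so that F - G is the mean of two differences with the same
    bound. *)
Lemma dyadic_resolvent k s r d (u : R[i]) :
  0 <= s <= rho -> 0 <= r <= rho -> `|s - r| <= d -> `|u| <= 1 ->
  exists F G,
    [/\ mutual_inverse (1 - ((s ^+ (2 ^ k))%:C * u) *: T ^+ (2 ^ k)) F,
        mutual_inverse (1 - ((r ^+ (2 ^ k))%:C * u) *: T ^+ (2 ^ k)) G,
        bounded_by U F m, bounded_by U G m &
        bounded_by U (F - G) (d * (m * t * m))].
Proof.
move=> /andP[s0 sr] /andP[r0 rr] srd; elim: k u => [|k IH] u u1.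
  have le z : 0 <= z -> z <= rho -> `|z%:C * u| <= rho%:C.
    move=> z0 zr; rewrite normrM norm_real_complex (ger0_norm z0).
    apply: (@le_trans _ _ z%:C); last by rewrite lecR.
    by rewrite ler_piMr // ler0c.
  have [F sF bF] := Tm (le _ s0 sr); have [G rG bG] := Tm (le _ r0 rr).
  exists F, G; rewrite expn0 !expr1; split => //.
  apply: (resolvent_lipschitz Uac U0 bT sF rG bF bG).
  rewrite -mulrBl -rmorphB normrM norm_real_complex.
  apply: (@le_trans _ _ `|s - r|%:C); last by rewrite lecR.
  by rewrite ler_piMr // ler0c.
have v1 : `|sqrtC u| <= 1.
  by rewrite -(@expr_le1 _ 2) // -normrX sqrtCK.
have [F1 [G1 [sF1 rG1 bF1 bG1 bFG1]]] := IH _ v1.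
have [|F2 [G2 [sF2 rG2 bF2 bG2 bFG2]]] := IH (- sqrtC u); first by rewrite normrN.
have E z : (z ^+ (2 ^ k.+1))%:C * u = (z ^+ (2 ^ k))%:C ^+ 2 * sqrtC u ^+ 2.
  by rewrite sqrtCK -rmorphXn -exprM mulnC -expnS.
exists (2^-1 *: (F1 + F2)), (2^-1 *: (G1 + G2)); rewrite !E; split.
- exact: dyadic_resolvent_mean.
- exact: dyadic_resolvent_mean.
- exact: bounded_by_mean.
- exact: bounded_by_mean.
- rewrite -scalerBr opprD addrACA; exact: bounded_by_mean.
Qed.

Definition dyadic_small s := forall e : R, 0 < e -> exists k0, forall k,
  (k0 <= k)%N -> bounded_by U ((s ^+ (2 ^ k))%:C *: T ^+ (2 ^ k)) e.

(* If [(1 - S)^-1] is within 1/4 of [(1 - S')^-1] and [S] is tiny, then the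
   latter is within 1/2 of 1, so its inverse [1 - S'] is bounded. *)
Lemma bounded_by_near_small (S S' F G : contop X) a b :
  mutual_inverse (1 - S) F -> mutual_inverse (1 - S') G ->
  bounded_by U F a -> bounded_by U S' b ->
  bounded_by U S (12^-1) -> bounded_by U (F - G) (4^-1) ->
  bounded_by U S' 4.
Proof.
move=> [SF _] [S'G _] bF bS' bS bFG.
have FE : F = 1 + S * F by rewrite -[in RHS]SF mulrBl mul1r subrK.
(* The constant 1/12 makes S F at most 3/12 = 1/4, which together with the 1/4 of F - G gives the
   1/2 that absorption needs for 1 - S'. *)
have {}bF : bounded_by U F 3.
  have -> : 3 = 1 * 2 + 1 :> R by lra.
  apply: (bounded_by_absorb Uac U0 _ bF) => // e be.
  have e0 : 0 <= e by case: be.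
  rewrite FE; apply: (bounded_by_le Uac U0).
    by apply: bounded_byD => //; [exact: bounded_by1|apply: bounded_byM bS be].
  lra.
have bG1 : bounded_by U (1 - G) (2^-1).
  have -> : 1 - G = F - G - S * F.
    by rewrite addrAC -[X in _ = X - _ - _]mul1r -mulrBl SF.
  apply: (bounded_by_le Uac U0).
    by apply: bounded_byB => //; [exact: bFG|apply: bounded_byM bS bF].
  lra.
have bP : bounded_by U (1 - S') (1 * 2 + 1).
  have bP' := bounded_byB Uac U0 bounded_by1 bS'.
  apply: (bounded_by_absorb Uac U0 _ bP') => // e be.
  have -> : 1 - S' = 1 + (1 - S') * (1 - G).
    by rewrite mulrBr mulr1 S'G [RHS]addrC subrK.
  by apply: bounded_byD => //; [exact: bounded_by1|apply: bounded_byM be bG1].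
have -> : S' = 1 - (1 - S') by rewrite subKr.
apply: (bounded_by_le Uac U0).
  by apply: bounded_byB => //; [exact: bounded_by1|exact: bP].
lra.
Qed.

(** At [r] the powers are only shown to be bounded, by 4. Decay at [s'] comes from s' < r: passing
    from [r] to [s'] brings in the factor (s'/r)^(2^k). *)
Lemma dyadic_small_step s s' r :
  0 <= s <= rho -> 0 <= s' < r -> r <= rho ->
  `|s - r| * (m * t * m) <= 4^-1 -> dyadic_small s -> dyadic_small s'.
Proof.
move=> s0 /andP[s'0 s'r] rr srL small.
have r0 : 0 < r by exact: le_lt_trans s'r.
have b4 : exists k0, forall k, (k0 <= k)%N ->
    bounded_by U ((r ^+ (2 ^ k))%:C *: T ^+ (2 ^ k)) 4.
  have [|k0 Hk0] := small (12^-1); first by rewrite invr_gt0.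
  exists k0 => k kk0; have u1 : `|1 : R[i]| <= 1 by rewrite normr1.
  have rr' : 0 <= r <= rho by rewrite ltW.
  have [F [G [sF rG bF bG bFG]]] := dyadic_resolvent k s0 rr' (lexx _) u1.
  rewrite !mulr1 in sF rG.
  apply: (bounded_by_near_small sF rG bF _ (Hk0 _ kk0)); last first.
    exact: bounded_by_le bFG srL.
  apply: bounded_byZ => //; last exact: bounded_byX bT.
  by rewrite norm_real_complex.
case: b4 => k0 b4 e e0.
have q1 : s' / r < 1 by rewrite ltr_pdivrMr // mul1r.
have q0 : 0 <= s' / r by rewrite divr_ge0 // ltW.
have /cvgrPdist_lt/(_ (e / 4)) : (fun n => (s' / r) ^+ n) @ \oo --> (0 : R).
  by apply: cvg_expr; rewrite ger0_norm.
case; first by rewrite divr_gt0.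
move=> n0 _ Hn; exists (maxn k0 n0) => k; rewrite geq_max => /andP[kk0 kn0].
have -> : (s' ^+ (2 ^ k))%:C *: T ^+ (2 ^ k) =
    ((s' / r) ^+ (2 ^ k))%:C *: ((r ^+ (2 ^ k))%:C *: T ^+ (2 ^ k)).
  by rewrite scalerA -rmorphM -exprMn divfK // gt_eqF.
have -> : e = e / 4 * 4 by lra.
apply: bounded_byZ; [exact: Uac|exact: U0| |exact: b4].
rewrite norm_real_complex lecR ltW //.
have /= := Hn (2 ^ k)%N; rewrite sub0r normrN; apply.
by rewrite (leq_trans kn0) // ltnW // ltn_expl.
Qed.

Lemma dyadic_small0 : dyadic_small 0.
Proof.
move=> e e0; exists 0%N => k _; rewrite expr0n expn_eq0 /= rmorph0 scale0r.
split; first exact: ltW.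
by move=> x _; exists 0 => //; rewrite scaler0.
Qed.

Lemma dyadic_small1 : 1 < rho -> dyadic_small 1.
Proof.
move=> rho1.
have [m0 t0] : 0 <= m /\ 0 <= t.
  split; last by case: bT.
  have [|F _ [//]] := Tm (z := 0).
  by rewrite normr0 ler0c (le_trans _ (ltW rho1)).
set L := m * t * m; have L0 : 0 <= L by rewrite !mulr_ge0.
(* The step from j/N to (j+1)/N looks ahead to r = (j+2)/N. The first term of [c] ensures (2/N) L <=
   1/4, the second r <= 1 + 1/N <= rho. *)
pose c := 8 * L + (rho - 1)^-1.
have c0 : 0 <= c by rewrite addr_ge0 ?mulr_ge0 // invr_ge0 subr_ge0 ltW.
pose N := Num.bound c; have cN : c < N%:R := archi_boundP c0.
have N0 : 0 < N%:R :> R by exact: le_lt_trans cN.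
have LN : 8 * L / N%:R <= 1.
  rewrite ler_pdivrMr // mul1r (le_trans _ (ltW cN)) // lerDl.
  by rewrite invr_ge0 subr_ge0 ltW.
have rN : N%:R^-1 <= rho - 1.
  rewrite -[leRHS]invrK lef_pV2 ?posrE ?invr_gt0 ?subr_gt0 //.
  by rewrite (le_trans _ (ltW cN)) // lerDr mulr_ge0.
have iN0 : 0 < N%:R^-1 :> R by rewrite invr_gt0.
suff small j : (j <= N)%N -> dyadic_small (j%:R / N%:R).
  by have := small N (leqnn _); rewrite divff // gt_eqF.
elim: j => [_|j IH jN]; first by rewrite mul0r; exact: dyadic_small0.
have jN1 : j.+1%:R / N%:R <= 1 :> R by rewrite ler_pdivrMr // mul1r ler_nat.
have jE : j.+1%:R / N%:R = j%:R / N%:R + N%:R^-1 :> R.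
  by rewrite -natr1 mulrDl mul1r.
have j0 : 0 <= j%:R / N%:R :> R by rewrite divr_ge0.
apply: (@dyadic_small_step (j%:R / N%:R) _ (j.+1%:R / N%:R + N%:R^-1)).
- by rewrite j0 /=; lra.
- by rewrite divr_ge0 // ltrDl.
- lra.
- rewrite jE; have -> : j%:R / N%:R - (j%:R / N%:R + N%:R^-1 + N%:R^-1) =
    - (2 * N%:R^-1) :> R by lra.
  rewrite normrN ger0_norm ?mulr_ge0 ?(ltW iN0) // -/L.
  by rewrite -mulrA [_^-1 * L]mulrC; move: LN; rewrite -mulrA; lra.
- by apply: IH; exact: ltnW.
Qed.

(** A single dyadic power T^N with bound 1/2 suffices: Euclidean division of [n] by [N] splits off
    (T^N)^(n/N), and the remaining factor is at most c^N. *)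
Lemma powers_vanish : 1 < rho ->
  forall e, 0 < e -> \forall n \near \oo, bounded_by U (T ^+ n) e.
Proof.
move=> /dyadic_small1 small.
have [|k0 /(_ _ (leqnn k0))] := small (2^-1); first by rewrite invr_gt0.
rewrite expr1n scale1r; set N := (2 ^ k0)%N => bN.
have N0 : (0 < N)%N by rewrite expn_gt0.
pose c := Num.max 1 t; have c1 : 1 <= c by rewrite le_max lexx.
have bTc : bounded_by U T c.
  by apply: (bounded_by_le Uac U0 bT); rewrite le_max lexx orbT.
have bn n : bounded_by U (T ^+ n) (2^-1 ^+ (n %/ N) * c ^+ N).
  rewrite {1}(divn_eq n N) exprD mulnC exprM.
  apply: bounded_byM; first exact: bounded_byX.
  apply: (bounded_by_le Uac U0 (bounded_byX _ bTc)).
  by rewrite ler_weXn2l // ltnW // ltn_mod.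
have cN0 : 0 < c ^+ N by rewrite exprn_gt0 // (lt_le_trans _ c1).
move=> e e0.
have /cvgrPdist_lt/(_ (e / c ^+ N)) : (fun n => 2^-1 ^+ n) @ \oo --> (0 : R).
  by apply: cvg_expr; rewrite ger0_norm ?invr_ge0 // invf_lt1 // ltr1n.
case; first by rewrite divr_gt0.
move=> n0 _ Hn; exists (n0 * N)%N => // n /= nn0.
apply: (bounded_by_le Uac U0 (bn n)); rewrite -ler_pdivlMr // ltW //.
have := Hn (n %/ N)%N; rewrite /= sub0r normrN ger0_norm ?exprn_ge0 ?invr_ge0 //.
by apply; rewrite leq_divRL.
Qed.

End dyadic_resolvents.

(** * Absolutely convex neighbourhoods of 0 *)

Lemma convex_set_le1 (K : numFieldType) (E : lmodType K) (C : set E)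
    (p q : K) (x y : E) :
  convex_set C -> C 0 -> C x -> C y -> 0 <= p -> 0 <= q -> p + q <= 1 ->
  C (p *: x + q *: y).
Proof.
move=> Cc C0 Cx Cy p0 q0 pq1.
have conv2 (l : K) (u v : E) : 0 <= l -> l <= 1 -> C u -> C v ->
    C (l *: u + (1 - l) *: v).
  move=> l0 l1 Cu Cv.
  exact/set_mem/(Cc u v (Itv01 l0 l1) (mem_set Cu) (mem_set Cv)).
have pq0 : 0 <= p + q by rewrite addr_ge0.
have [pq|pq] := eqVneq (p + q) 0.
  move/eqP: pq; rewrite paddr_eq0 // => /andP[/eqP -> /eqP ->].
  by rewrite !scale0r addr0.
(* The weight missing from 1 goes to the point 0: the target is p + q times this convex
   combination. *)
have Cm : C ((p / (p + q)) *: x + (1 - p / (p + q)) *: y).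
  apply: conv2 => //; first by rewrite divr_ge0.
  by rewrite ler_pdivrMr ?mul1r ?lerDl // lt_neqAle eq_sym pq.
have := conv2 _ _ _ pq0 pq1 Cm C0; rewrite scaler0 addr0 scalerDr !scalerA.
have -> : (p + q) * (p / (p + q)) = p by field.
by have -> : (p + q) * (1 - p / (p + q)) = q by field.
Qed.

(** The balanced core of a convex neighbourhood stays convex, and continuity of scalar
    multiplication at (0, 0) makes it a neighbourhood. *)
Lemma nbhs0_absolutely_convex (K : numFieldType) (X : tvsType K) (V : set X) :
  nbhs 0 V -> exists U, [/\ nbhs 0 U, absolutely_convex U & U `<=` V].
Proof.
move=> V0; have [B Bc [Bo Bn]] := @locally_convex K X.
have [C [BC C0] CV] := Bn 0 V V0.
have Cc : convex_set C by apply: Bc; exact/mem_set.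
have [W W0 WC] : exists2 W, nbhs 0 W &
    forall (a : K) x, `|a| <= 1 -> W x -> C (a *: x).
  by apply: nbhs0_balanced; apply: open_nbhs_nbhs; split=> //; exact: Bo.
exists [set x | forall a : K, `|a| <= 1 -> C (a *: x)]; split.
- by apply: filterS W0 => x Wx a a1; exact: WC.
- move=> a b x y ab1 Ux Uy e e1.
  (* Phases go into the vectors, where the core absorbs them; convexity only has to handle the
     nonnegative weights |a| and |b|. *)
  have phase (c : K) : exists2 d, `|d| <= 1 & c = `|c| * d.
    have [->|c0] := eqVneq c 0; first by exists 0; rewrite ?normr0 ?mul0r.
    exists (c / `|c|); last by rewrite mulrC divfK ?normr_eq0.
    by rewrite normf_div normr_id divff // normr_eq0.
  have [d d1 ->] := phase a; have [d' d'1 ->] := phase b.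
  rewrite scalerDr !scalerA !(mulrCA e) -!scalerA.
  apply: convex_set_le1 => //.
  + by rewrite scalerA; apply: Ux; rewrite normrM mulr_ile1.
  + by rewrite scalerA; apply: Uy; rewrite normrM mulr_ile1.
- by move=> x Ux; apply: CV; rewrite -[x]scale1r; apply: Ux; rewrite normr1.
Qed.

(** * From the spectrum to the resolvent *)

Lemma closure_ball0_norm_le (R : realType) (d : R) (l : R[i]^o) :
  closure (ball (0 : R[i]^o) d%:C) l -> `|l| <= d%:C.
Proof.
move=> cl; apply/negPn/negP => nld.
have dl : 0 < `|l| - d%:C.
  by rewrite subr_gt0 real_ltNge // ?normr_real //; apply/complex_realP; exists d.
have [z [/= zd zl]] := cl _ (nbhsx_ballx l _ dl).
move: zd zl; rewrite -!ball_normE /= sub0r normrN => zd zl.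
have := ler_normB (l - z) (- z); rewrite opprK subrK normrN.
by move=> /le_lt_trans/(_ (ltrD zl zd)); rewrite subrK ltxx.
Qed.

(** For nonzero [z], 1 - z T = z (z^-1 - T), and |z^-1| >= 1/rho > d puts z^-1 outside the
    spectrum. *)
Lemma spectrum_disc_inverse (R : realType) (X : tvsType R[i]) (T : contop X)
    (d rho : R) (z : R[i]) :
  spectrum T `<=` closure (ball (0 : R[i]^o) d%:C) -> 0 <= d -> d * rho < 1 ->
  `|z| <= rho%:C -> exists F, mutual_inverse (1 - z *: T) F.
Proof.
move=> spT d0 drho zrho; have [->|z0] := eqVneq z 0.
  by exists 1; rewrite scale0r subr0 /mutual_inverse mulr1.
have [/spT/closure_ball0_norm_le|/contrapT[S [TS ST]]] := pselect (spectrum T z^-1).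
  rewrite normfV => zd; exfalso.
  have : 1 <= (d * rho)%:C :> R[i].
    rewrite rmorphM -(@mulVf _ `|z|) ?normr_eq0 //.
    by apply: ler_pM => //; rewrite invr_ge0.
  by rewrite -(rmorph1 (real_complex R)) lecR leNgt drho.
exists (z^-1 *: S).
have -> : 1 - z *: T = z *: (z^-1 *: (1 : contop X) - T).
  by rewrite scalerBr scalerA divff // scale1r.
split; rewrite contop_scalerAl contop_scalerAr scalerA ?mulVf ?divff // scale1r //.
Qed.

(** * From gauge bounds to convergence in L_b(X) *)

Section bounded_operator_iterates.
Context {R : realType} {X : tvsType R[i]} {U : set X} {T : contop X}.
Context (U0 : nbhs 0 U) (bT : tvs_bounded (T @` U)).

Lemma contop_comp_bounded_by (F : contop X) :
  exists r : R, bounded_by U (F * T) r.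
Proof.
have FU : nbhs 0 (F @^-1` U).
  by apply: (@contop_continuous _ _ F 0); rewrite linear0.
have [r r0 TU] := bT FU; exists (complex.Re r).
have rE : (complex.Re r)%:C = r by rewrite RRe_real // gtr0_real.
split; first by rewrite -ler0c rE ltW.
move=> x Ux; have [y Fy yE] := TU _ (imageP T Ux).
by exists (F y) => //; rewrite contopME -yE linearZ rE.
Qed.

(** If [B] lies in rU and T(U) in sW, the bound 1/(rs) on [A n] makes T (A n) send [B] into [W].
    Choosing [W] with aW inside [V] for |a| <= 1 also absorbs the sign in 0 - T (A n). *)
Lemma cvg_comp_vanishing (A : nat -> contop X) :
  (forall e : R, 0 < e -> \forall n \near \oo, bounded_by U (A n) e) ->
  (fun n => T * A n) @ \oo --> (0 : contop X).
Proof.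
move=> A0 P /contop_nbhsP[B [V [bB V0 VP]]].
have [W W0 WV] := nbhs0_balanced V0.
have [s s0 TW] := bT W0; have [r r0 BU] := bB _ U0.
have rs0 : 0 < (r * s)^-1 by rewrite invr_gt0 mulr_gt0.
have eE : (complex.Re (r * s)^-1)%:C = (r * s)^-1.
  by rewrite RRe_real // gtr0_real.
have e0 : 0 < complex.Re (r * s)^-1 by rewrite -ltcR eE.
apply: filterS (A0 _ e0) => n [_ bA] /=; apply: VP => x /BU[u /bA[v Uv Av] <-].
have [w Ww Tv] := TW _ (imageP T Uv).
rewrite contop0E sub0r contopME linearZ /= Av eE !linearZ /= -Tv.
rewrite -scaleNr !scalerA.
apply: WV => //.
have -> : r * (r * s)^-1 * - s = - 1 by field; rewrite !gt_eqF.
by rewrite normrN1.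
Qed.

End bounded_operator_iterates.

(** * The three conclusions *)

Theorem theorem6p2 (R : realType) (X : tvsType R[i]) (T : contop X) (delta : R) :
  hausdorff_space X ->
  locally_complete X ->
  bounded_operator T ->
  0 < delta < 1 ->
  spectrum T `<=` closure (ball (0 : R[i]^o) delta%:C) ->
  [/\ (fun n : nat => T ^+ n) @ \oo --> (0 : contop X),
      power_bounded T &
      uniformly_mean_ergodic T].
Proof.
move=> _ _ [U1 U10 bT1] /andP[d0 d1] spT.
have [U [U0 Uac UU1]] := nbhs0_absolutely_convex U10.
have U00 : U 0 := nbhs_singleton U0.
have bT : tvs_bounded (T @` U).
  move=> V /bT1[r r0 TV]; exists r => //.
  by apply: subset_trans TV; exact: image_subset.
have bFT := contop_comp_bounded_by U0 bT.
have [t bTt] := bFT 1; rewrite mul1r in bTt.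
(* Any value strictly between 1 and 1/delta would do. *)
pose rho := 2 / (1 + delta).
have rho1 : 1 < rho by rewrite ltr_pdivlMr; lra.
have drho : delta * rho < 1 by rewrite mulrA ltr_pdivrMr; lra.
have inv z : `|z| <= rho%:C -> exists F, mutual_inverse (1 - z *: T) F.
  by apply: spectrum_disc_inverse spT _ drho; exact: ltW.
have [m Tm] := resolvent_uniformly_bounded Uac U00 bTt bFT inv.
have pow0 := powers_vanish Uac U00 bTt Tm rho1.
(* From [n0] on the bound is 1; the finitely many earlier powers are at most max(1, t)^n0. *)
have [M bM] : exists M : R, forall n, bounded_by U (T ^+ n) M.
  have [n0 _ Hn] := pow0 1 ltr01.
  have c1 : 1 <= Num.max 1 t by rewrite le_max lexx.
  have bTc : bounded_by U T (Num.max 1 t).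
    by apply: (bounded_by_le Uac U00 bTt); rewrite le_max lexx orbT.
  exists (Num.max 1 t ^+ n0) => n; have [nn0|n0n] := leqP n0 n.
    by apply: (bounded_by_le Uac U00 (Hn _ nn0)); rewrite exprn_ege1.
  apply: (bounded_by_le Uac U00 (bounded_byX n bTc)).
  by rewrite ler_weXn2l // ltnW.
have M0 : 0 <= M by case: (bM 0%N).
split.
- move=> P /(cvg_comp_vanishing U0 bT pow0)[N _ NP].
  by exists N.+1 => // -[//|n] Nn /=; rewrite exprS; exact: NP.
- move=> V V0; have [W W0 WV] := nbhs0_balanced V0.
  have [s s0 TW] := bT _ W0.
  (* T^n maps [U] into (M+1)U and [T] maps [U] into sW, so [U] is shrunk by (M+1)s. Using M + 1
     keeps this factor invertible when M = 0. *)
  have c0 : (M + 1)%:C * s != 0.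
    rewrite mulf_neq0 ?gt_eqF //.
    by rewrite -(rmorph0 (real_complex R)) ltcR ltr_wpDl.
  exists (( *:%R ((M + 1)%:C * s)^-1) @` U).
    by apply: nbhs0Z => //; rewrite invr_eq0.
  move=> _ [[//|n] _ <-] _ [_ [u Uu <-] <-].
  have [v Uv Tv] : exists2 v, U v & (T ^+ n) u = (M + 1)%:C *: v.
    have [|_ /(_ u Uu)//] := bounded_by_le Uac U00 (bM n) (d := M + 1).
    by rewrite lerDl.
  have [w Ww Tw] := TW _ (imageP T Uv).
  rewrite exprS contopME !linearZ /= Tv linearZ /= -Tw !scalerA.
  rewrite -[_^-1 * _ * _]mulrA mulVf //.
  by apply: WV Ww; rewrite normr1.
- exists 0.
  (* As rho > 1, the point 1 lies in the disc, and [F] = (1 - T)^-1 sums the geometric series with a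
     bound independent of [n]. *)
  have [|F [_ FT] bF] := Tm 1.
    by rewrite normr1 -(rmorph1 (real_complex R)) lecR ltW.
  rewrite scale1r in FT.
  have -> : ergodic_mean T = fun n => T * (n%:R^-1 *: \sum_(i < n) T ^+ i).
    apply/funext => n; rewrite contop_scalerAr mulr_sumr /ergodic_mean.
    by rewrite big_add1 big_mkord; under eq_bigr do rewrite exprS.
  have sumE n : \sum_(i < n) T ^+ i = F * (1 - T ^+ n).
    move/(congr1 -%R): (subrX1 T n); rewrite -mulNr !opprB => ->.
    by rewrite mulrA FT mul1r.
  apply: cvg_comp_vanishing U0 bT _ _ => e e0.
  have m0 : 0 <= m by case: bF.
  (* The successor forces n > 0, so that dividing by [n] is legitimate. *)
  exists (Num.bound (m * (1 + M) / e)).+1 => // n /= ne.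
  have n0 : 0 < n%:R :> R by rewrite ltr0n (leq_trans _ ne).
  have bsum : bounded_by U (\sum_(i < n) T ^+ i) (m * (1 + M)).
    rewrite sumE; apply: bounded_byM => //; apply: bounded_byB => //.
    exact: bounded_by1.
  apply: (bounded_by_le Uac U00 (bounded_byZ Uac U00 (d := n%:R^-1) _ bsum)).
    by rewrite normfV normr_nat fmorphV rmorph_nat.
  rewrite mulrC ler_pdivrMr // -ler_pdivrMl // mulrC.
  apply: (le_trans (ltW (archi_boundP _))).
    by rewrite divr_ge0 ?mulr_ge0 ?addr_ge0 // ltW.
  by rewrite ler_nat ltnW.
Qed.
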